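(* For every constant number $n\ge 2$ of agents there is a constant $c>0$ (depending only on $n$) such that for all integers $m\ge n$ and $k\ge 1$ there is a $k$-query algorithm that, for every instance with $n$ agents and $m$ goods, computes an allocation that is $$\frac{c}{\sqrt{k}\cdot m^{1/(2k-1)}}\text{-EFX},$$ i.e., for constant $n$ an EFX approximation of $\Omega\Big(\frac{1}{\sqrt{k}\, m^{1/(2k-1)}}\Big)$ is achievable with $k$ queries per agent.
   Context: There is a set $N=\{1,\dots,n\}$ of $n\ge 2$ agents and a set $G$ of $m\ge n$ goods. Each agent $i$ has a valuation function $v_i:G\to\mathbb{R}_{\ge 0}$, extended additively to bundles: $v_i(X)=\sum_{g\in X}v_i(g)$ for $X\subseteq G$. An allocation is a tuple $(X_i)_{i\in N}$ of pairwise disjoint (possibly empty) bundles with $\bigcup_{i}X_i=G$. For $\alpha\in[0,1]$, an allocation is $\alpha$-EFX if for all agents $i\ne j$ with $X_j\neq\varnothing$ and every $g\in X_j$, $v_i(X_i)\ge\alpha\cdot v_i(X_j\setminus\{g\})$. A ranking (strict linear order) $\succ_i$ of $G$ is consistent with $v_i$ if $g\succ_i g'$ implies $v_i(g)\ge v_i(g')$. An instance consists of valuations together with rankings consistent with them. A $k$-query algorithm is a deterministic algorithm that receives as input the rankings $(\succ_i)_{i\in N}$, may (adaptively) make at most $k$ value queries per agent, where a value query names an agent $i$ and a good $g$ and returns $v_i(g)$, and finally outputs an allocation. *)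

(* Defs.v *)
From HB Require Import structures.
From mathcomp Require Import all_boot all_order all_algebra.
From mathcomp Require Import reals exp.

Set Implicit Arguments.
Unset Strict Implicit.
Unset Printing Implicit Defensive.

Import Order.TTheory GRing.Theory Num.Theory.
Local Open Scope ring_scope.

Definition strict_linear_order (T : Type) (r : rel T) : Prop :=
  [/\ irreflexive r, transitive r & forall x y, x <> y -> r x y \/ r y x].

(* [prefers I i g g'] is "agent i ranks g strictly above g'". *)
Record instance (R : realType) (n : nat) (G : finType) := Instance {
  value : 'I_n -> G -> R;
  prefers : 'I_n -> rel G;
  value_ge0 : forall i g, 0 <= value i g;
  prefers_slo : forall i, strict_linear_order (prefers i);
  prefers_consistent :
    forall i g g', prefers i g g' -> value i g' <= value i g }.

Record allocation (n : nat) (G : finType) := Allocation {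
  bundle :> 'I_n -> {set G};
  bundle_disjoint : forall i j, i != j -> [disjoint bundle i & bundle j];
  bundle_cover : \bigcup_i bundle i = [set: G] }.

Definition bundle_value (R : realType) (n : nat) (G : finType)
    (v : 'I_n -> G -> R) (i : 'I_n) (S : {set G}) : R :=
  \sum_(g in S) v i g.

Definition EFX (R : realType) (n : nat) (G : finType)
    (alpha : R) (v : 'I_n -> G -> R) (X : allocation n G) : Prop :=
  0 <= alpha <= 1 /\
  forall i j, i != j -> X j != set0 -> forall g, g \in X j ->
    bundle_value v i (X i) >= alpha * bundle_value v i (X j :\ g).

(* A deterministic adaptive interaction is a decision tree: a node names an
   agent and a good, and the subtree taken next depends on the answer, an
   arbitrary real, so the tree has infinite branching but finite depth along
   every branch. *)
Inductive query_tree (R : realType) (n : nat) (G : finType) : Type :=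
| Output of allocation n G
| Query of 'I_n & G & (R -> query_tree R n G).

Fixpoint run (R : realType) (n : nat) (G : finType)
    (t : query_tree R n G) (v : 'I_n -> G -> R) : allocation n G :=
  match t with
  | Output X => X
  | Query i g next => run (next (v i g)) v
  end.

Fixpoint num_queries (R : realType) (n : nat) (G : finType)
    (t : query_tree R n G) (v : 'I_n -> G -> R) (i : 'I_n) : nat :=
  match t with
  | Output _ => 0%N
  | Query j g next => ((j == i) + num_queries (next (v j g)) v i)%N
  end.

(* The rankings are the only information available without queries. *)
Definition algorithm (R : realType) (n : nat) (G : finType) : Type :=
  ('I_n -> rel G) -> query_tree R n G.

Definition k_query (R : realType) (n : nat) (G : finType) (k : nat)
    (A : algorithm R n G) : Prop :=
  forall (I : instance R n G) (i : 'I_n),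
    (num_queries (A (prefers I)) (value I) i <= k)%N.

Definition outcome (R : realType) (n : nat) (G : finType)
    (A : algorithm R n G) (I : instance R n G) : allocation n G :=
  run (A (prefers I)) (value I).

(* Main.v *)
(* Let [a = m ^ (1 / (2k - 1))] and [beta = 1 / (a sqrt k)], and process the
   agents one after the other.  An agent queries, in its ranking of the goods
   still available, the best good [h_0] and the goods [h_p] at the positions
   [p_j ~ 2 n a ^ (2j + 1)], [j < k - 1]; these positions reach [m] at
   [j = k - 1].
   - If [p_j v(h_(p_j)) < beta v(h_0)] for all [j], then summing over the blocks
     between the positions bounds the value of all the other goods by
     [(p_0 + 2 k a ^ 2 beta) v(h_0) = O(n a sqrt k) v(h_0)]: the agent takes
     [h_0] and leaves.  Nobody envies a singleton after removing a good.
   - Otherwise the goods are worth at least [(beta / 2) v(h_0)] to the agent even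
     after deleting any [n - 1] of them, and the agent waits.  This remains true
     when another agent leaves with one good, so no new queries are needed.
   The waiting agents share the remaining goods by round-robin, where each gets a
   [1 / n] fraction of the goods other than some [n - 1] of them. *)
Require Import Defs.
From mathcomp Require Import all_boot all_order all_algebra.
From mathcomp Require Import reals exp.
From mathcomp Require Import boolp zify ring lra.
Import Order.TTheory GRing.Theory Num.Theory.
Local Open Scope ring_scope.

(** * Rankings, balanced sets of goods and the query test *)

Section Rankings.
Set Implicit Arguments.
Unset Strict Implicit.
Variables (R : realType) (G : finType).
Implicit Types (r : rel G) (v : G -> R) (M D : {set G}).

Definition consistent r v : Prop :=
  (forall g, 0 <= v g) /\ (forall g g', r g g' -> v g' <= v g).

(** [h] is chosen before [v]: it comes from the ranking alone and serves every consistent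
    valuation. *)
Lemma sorted_goods r M : strict_linear_order r ->
  exists h : seq G, [/\ uniq h, h =i M &
    forall v, consistent r v -> forall x0 i j,
      (i <= j)%N -> (j < size h)%N -> v (nth x0 h j) <= v (nth x0 h i)].
Proof.
case=> _ rT rtot; pose le x y := (x == y) || r x y.
have leT : transitive le.
  move=> y x z /orP[/eqP->//|rxy] /orP[/eqP<-|ryz]; rewrite /le ?rxy ?orbT //.
  by rewrite (rT _ _ _ rxy ryz) orbT.
have letot : total le.
  move=> x y; rewrite /le; have [->|/eqP/rtot[->|->]] := eqVneq x y; by rewrite ?orbT.
exists (sort le (enum M)); split.
- by rewrite sort_uniq enum_uniq.
- by move=> x; rewrite mem_sort mem_enum.
move=> v [_ vr] x0 i j ij js.
have := sorted_leq_nth leT (fun x => introT orP (or_introl (eqxx x))) x0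
  (sort_sorted letot (enum M)) i j.
rewrite !inE => /(_ (leq_ltn_trans ij js) js ij) /orP[/eqP->//|].
exact: vr.
Qed.

Lemma top_good r M : strict_linear_order r -> M != set0 ->
  exists2 g, g \in M &
    forall v, consistent r v -> forall x, x \in M -> v x <= v g.
Proof.
move=> /(sorted_goods M)[h [_ hM hv]] /set0Pn[x0]; rewrite -hM => x0h.
have h0 : (0 < size h)%N by case: h x0h {hM hv}.
exists (nth x0 h 0); first by rewrite -hM mem_nth.
move=> v cv x; rewrite -hM => xh; rewrite -{1}(nth_index x0 xh).
by apply: hv; rewrite ?index_mem.
Qed.

Lemma ler_sum_subset v (A B : pred G) : (forall x, 0 <= v x) ->
  (forall x, A x -> B x) -> \sum_(x | A x) v x <= \sum_(x | B x) v x.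
Proof.
move=> v0 AB; rewrite big_mkcond [leRHS]big_mkcond /=; apply: ler_sum => x _.
by case: ifP => [/AB->//|_]; case: ifP.
Qed.

Lemma sum_le_card v (A : {set G}) (b : R) (s : nat) :
  0 <= b -> (#|A| <= s)%N ->
  (forall x, x \in A -> v x <= b) -> \sum_(x in A) v x <= s%:R * b.
Proof.
move=> b0 As vb; apply: (@le_trans _ _ (\sum_(x in A) b)); first exact: ler_sum.
by rewrite sumr_const -[leLHS]mulr_natl ler_wpM2r // ler_nat.
Qed.

Lemma sum_setD_setI v (A D : {set G}) :
  \sum_(x in A) v x = \sum_(x in A :&: D) v x + \sum_(x in A :\: D) v x.
Proof.
rewrite (bigID (mem D)) /=; congr (_ + _); apply: eq_bigl => x;
  by rewrite !inE // andbC.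
Qed.

(** [s] stands for the number of agents still present: round-robin costs a waiting agent at most
    [s - 1] goods, collected in [D]. Comparing with every [g] in [M] lets the property survive the
    removal of a good, even of the best one. *)
Definition balanced (gamma : R) (s : nat) v M : Prop :=
  forall D, (#|D| < s)%N ->
    forall g, g \in M -> gamma * v g <= \sum_(x in M :\: D) v x.

(** The departed good is charged to the deleted set, as [g |: D]. *)
Lemma balanced_setD1 gamma s v M g :
  balanced gamma s.+1 v M -> balanced gamma s v (M :\ g).
Proof.
move=> bal D Ds x; rewrite inE => /andP[_ xM].
rewrite setDDl; apply: bal => //.
by rewrite cardsU1; case: (g \in D) => //=; rewrite ltnS ltnW.
Qed.

Lemma balanced_leq gamma s t v M :
  (t <= s)%N -> balanced gamma s v M -> balanced gamma t v M.
Proof. by move=> ts bal D Dt; apply: bal; exact: leq_trans ts. Qed.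

(** Cut at the positions [p j]: the block starting at [p j] has at most [p j.+1] terms, each at most
    [w (p j)]. *)
Lemma sum_blocks (w : nat -> R) (p : nat -> nat) (K : nat) (e : R) :
  (forall i, 0 <= w i) -> (forall i j, (i <= j)%N -> w j <= w i) ->
  (forall j, (j < K)%N -> (p j.+1)%:R * w (p j) <= e) ->
  \sum_(0 <= i < p K) w i <= (p 0%N)%:R * w 0%N + K%:R * e.
Proof.
move=> w0 wD; have block a b : \sum_(a <= i < b) w i <= b%:R * w a.
  apply: (@le_trans _ _ (\sum_(a <= i < b) w a)).
    by apply: ler_sum_nat => i /andP[ai _]; exact: wD.
  by rewrite sumr_const_nat -[leLHS]mulr_natl ler_wpM2r // ler_nat leq_subr.
elim: K => [|K IH] pe; first by rewrite mul0r addr0 block.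
have [|/ltnW pK] := leqP (p K) (p K.+1) => [pK|].
  rewrite (big_cat_nat _ pK) //= -natr1 mulrDl mul1r addrA lerD //.
    by apply: IH => j /leqW; exact: pe.
  by apply: le_trans (pe K _).
(* Here [p] does not increase at [K]: the sum can only shrink, while the bound grows by [e]. *)
have e0 : 0 <= e by apply: le_trans (pe 0%N _); rewrite // mulr_ge0.
apply: (@le_trans _ _ (\sum_(0 <= i < p K) w i)).
  by rewrite [leRHS](big_cat_nat _ pK) //= lerDl sumr_ge0.
apply: le_trans (IH _) _ => [j /leqW|]; first exact: pe.
by rewrite lerD2l ler_wpM2r // ler_nat.
Qed.

(** If the test succeeds at [j], the best [p j + 1] goods lose fewer than [N <= p j / 2] to [D], so
    at least [p j / 2] survive, each worth at least the good at position [p j]. If it fails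
    everywhere, [sum_blocks] applies. [g], [gs] and [test] precede [v], as an algorithm sees only
    the ranking and the answers. *)
Lemma query_test r M (N k : nat) (p : nat -> nat) (beta rho : R) :
  strict_linear_order r -> M != set0 -> 0 <= beta -> 0 <= rho -> (0 < k)%N ->
  (forall j, N.*2 <= p j)%N -> (#|M| <= p k.-1)%N ->
  (forall j, (p j.+1)%:R <= rho * (p j)%:R) ->
  exists g (gs : seq G) (test : seq R -> bool), [/\ g \in M, size gs = k &
    forall v, consistent r v ->
      if test (map v gs) then balanced (beta / 2) N v M
      else \sum_(x in M :\ g) v x <=
             ((p 0%N)%:R + k%:R * (rho * beta)) * v g].
Proof.
move=> rS /set0Pn[x0 x0M] beta0 rho0 k0 pN pM prho.
have [h [hU hM hv]] := sorted_goods M rS.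
have h0 : (0 < size h)%N by move: x0M; rewrite -hM; case: h {hU hM hv}.
have hs : size h = #|M| by rewrite -(card_uniqP hU); apply: eq_card.
(* Answer [0] concerns the top good, answer [j.+1] the good at position [p j]. A position past the
   end of [h] yields a dummy query of [x0], which [test] ignores. *)
pose g := nth x0 h 0; pose pos j := if j is i.+1 then p i else 0%N.
pose gs := mkseq (fun j => nth x0 h (pos j)) k.
pose test (l : seq R) := has (fun j => (p j < size h)%N &&
  (beta * nth 0 l 0 <= (p j)%:R * nth 0 l j.+1)) (iota 0 k.-1).
exists g, gs, test; split.
- by rewrite -hM mem_nth.
- by rewrite size_mkseq.
move=> v cv; have v0 := cv.1; have hvv := hv v cv x0.
have ans j : (j < k)%N -> nth 0 (map v gs) j = v (nth x0 h (pos j)).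
  by move=> jk; rewrite (nth_map x0) ?size_mkseq // nth_mkseq.
case: ifPn => [/hasP[j]|/hasPn noj].
  rewrite mem_iota add0n => /= jk /andP[pj].
  rewrite !ans //; last by rewrite -(prednK k0) ltnS.
  rewrite /= -/g => bp D DN x xM.
  pose T := [set y in take (p j).+1 h].
  have cT : #|T| = (p j).+1.
    by rewrite cardsE (card_uniqP _) ?take_uniq // size_takel.
  have TM : T :\: D \subset M :\: D.
    by apply: setSD; apply/subsetP => y; rewrite inE => /mem_take; rewrite hM.
  have lowT y : y \in T :\: D -> v (nth x0 h (p j)) <= v y.
    rewrite !inE => /andP[_ yT]; have := yT; rewrite -index_mem => iy.
    have it : (index y (take (p j).+1 h) <= p j)%N.
      by rewrite -ltnS -[X in (_ < X)%N](size_takel pj).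
    by rewrite -(nth_index x0 yT) nth_take //; apply: hvv.
  have xg : v x <= v g.
    rewrite -(nth_index x0 (_ : x \in h)) ?hM //; apply: hvv => //.
    by rewrite index_mem hM.
  apply: (@le_trans _ _ (\sum_(y in T :\: D) v (nth x0 h (p j)))); last first.
    apply: (@le_trans _ _ (\sum_(y in T :\: D) v y)); first exact: ler_sum.
    by apply: ler_sum_subset => // y; exact: (subsetP TM).
  rewrite sumr_const -[leRHS]mulr_natl.
  have card2 : (p j)%:R <= 2 * (#|T :\: D|%:R : R).
    rewrite -natrM ler_nat cardsD cT.
    have := subset_leq_card (subsetIr T D); have := pN j.
    rewrite mul2n -!addnn; move: DN; clear; move: #|D| #|_ :&: _| => d e.
    by lia.
  have /(ler_wpM2r (v0 (nth x0 h (p j)))) := card2.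
  have /(ler_wpM2l beta0) := xg; lra.
(* Extension by zero, since positions may exceed the number of goods. *)
pose w i := if (i < size h)%N then v (nth x0 h i) else 0.
have w0 i : 0 <= w i by rewrite /w; case: ifP.
have wD i j : (i <= j)%N -> w j <= w i.
  move=> ij; rewrite /w; case: ltnP => js; last by case: ifP.
  by rewrite (leq_ltn_trans ij js) hvv.
have wg : w 0%N = v g by rewrite /w h0.
have step j : (j < k.-1)%N -> (p j.+1)%:R * w (p j) <= rho * beta * v g.
  move=> jk; apply: (@le_trans _ _ (rho * (p j)%:R * w (p j))).
    by rewrite ler_wpM2r.
  rewrite -!mulrA ler_wpM2l //; rewrite /w; case: ltnP => ps; last first.
    by rewrite mulr0 mulr_ge0.
  have := noj j; rewrite mem_iota add0n => /(_ jk); rewrite ps /=.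
  rewrite !ans // -?ltNge; last by rewrite -(prednK k0) ltnS.
  exact: ltW.
have := sum_blocks w0 wD step; rewrite wg => bound.
apply: (@le_trans _ _ (\sum_(x in M) v x)).
  by apply: ler_sum_subset => // x; rewrite !inE => /andP[].
have -> : \sum_(x in M) v x = \sum_(0 <= i < size h) w i.
  rewrite (eq_bigl (mem h)); last by move=> x; rewrite /= hM.
  rewrite -big_uniq //= (big_nth x0); apply: eq_big_nat => i /= ih.
  by rewrite /w ih.
apply: (@le_trans _ _ (\sum_(0 <= i < p k.-1) w i)).
  rewrite -hs in pM.
  by rewrite [leRHS](big_cat_nat _ pM) //= lerDl sumr_ge0.
apply: le_trans bound _; rewrite mulrDl lerD2l -[leRHS]mulrA.
by rewrite ler_wpM2r ?mulr_ge0 // ler_nat leq_pred.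
Qed.

End Rankings.

(** * Round-robin and its fairness on balanced sets *)

Section RoundRobin.
Set Implicit Arguments.
Unset Strict Implicit.
Variables (R : realType) (n : nat) (G : finType).
Variable rk : 'I_n -> rel G.
Hypothesis rkS : forall i, strict_linear_order (rk i).

(* The first agent of [L] picks its favourite good and moves to the end of [L];
   the agent at position [t] then loses at most [t] goods before its turn. *)
Lemma round_robin (L : seq 'I_n) (M : {set G}) : uniq L -> L != [::] ->
  exists f : G -> 'I_n, (forall x, f x \in L) /\
    forall i, i \in L -> forall v : G -> R, consistent (rk i) v ->
      exists2 D : {set G}, (#|D| <= index i L)%N &
        \sum_(x in M :\: D) v x <=
          (size L)%:R * \sum_(x in M | f x == i) v x.
Proof.
have [m Mm] := ubnP #|M|; elim: m => // m IH in M Mm L *.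
case: L => // i L /= /andP[iL LU] _.
have [->|M0] := eqVneq M set0.
  exists (fun=> i); split=> [x|j _ v [v0 _]]; first exact: mem_head.
  exists set0; rewrite ?cards0 // set0D big_set0 mulr_ge0 //.
  exact: sumr_ge0.
have [g gM gtop] := top_good R (rkS i) M0.
have [|||f [fL fP]] := IH (M :\ g) _ (rcons L i).
- by move: Mm; rewrite (cardsD1 g) gM.
- by rewrite rcons_uniq iL.
- by case: L {iL LU}.
exists (fun x => if x == g then i else f x); split=> [x|j jL v cv].
  case: eqP => _; first exact: mem_head.
  by have := fL x; rewrite mem_rcons.
have v0 := cv.1; rewrite size_rcons in fP.
have [|D Dj Ds] := fP j _ v cv; first by rewrite mem_rcons.
pose S := \sum_(x in M :\ g | f x == j) v x.
(* The agent picking [g] later loses at most [size L] goods, each worth at most [v g]; [size L] of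
   the [(size L).+1] copies of [g] on the right pay for them, so nothing is deleted. *)
have [ij|ij] := eqVneq i j.
  exists set0; rewrite ?cards0 // setD0.
  have -> : \sum_(x in M | (if x == g then i else f x) == j) v x = v g + S.
    rewrite (bigD1 g) ?gM ?eqxx ?ij //=; congr (_ + _); apply: eq_bigl => x.
    rewrite !inE; case: (x == g); rewrite ?andbF ?andbT //.
  rewrite (big_setD1 g gM) (sum_setD_setI v _ D) /=.
  have DL : (#|(M :\ g) :&: D| <= size L)%N.
    apply: leq_trans (subset_leq_card (subsetIr _ _)) (leq_trans Dj _).
    by rewrite -ij -cats1 index_cat (negPf iL) /= eqxx addn0.
  have vDL : \sum_(x in (M :\ g) :&: D) v x <= (size L)%:R * v g.
    rewrite -ij in cv; apply: sum_le_card => // x /setIP[/setD1P[_ xM] _].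
    exact: gtop cv _ xM.
  by move: Ds; rewrite -/S -natr1; lra.
(* Any other agent stands one place further forward in the recursive call, which pays for deleting
   [g]. *)
exists (g |: D).
  rewrite cardsU1; apply: (@leq_trans #|D|.+1); first by case: (g \in D).
  move: jL Dj; rewrite inE eq_sym (negPf ij) /= => jL.
  by rewrite -cats1 index_cat jL.
rewrite -setDDl; apply: le_trans Ds _; rewrite ler_wpM2l //.
apply: ler_sum_subset => // x; rewrite !inE => /andP[/andP[/negPf-> ->]].
exact.
Qed.

(** The EFX condition of agent [i] inside [M], where [f] maps a good to its owner; the removed good
    [g] itself names the envied bundle. *)
Definition fair (alpha : R) (v : G -> R) (M : {set G}) (f : G -> 'I_n) i :=
  forall g, g \in M -> f g != i ->
    alpha * \sum_(x in M :\ g | f x == f g) v x <= \sum_(x in M | f x == i) v x.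

(** Let [B] be the value outside the deleted set [D]. Balance bounds [gamma] times each good of [D]
    in [M] by [B], so [gamma] times all of [M] is at most [n B], and round-robin gives [B <= n X]
    for the own share [X]. *)
Lemma round_robin_fair (gamma : R) (L : seq 'I_n) (M : {set G}) :
  0 < gamma <= 1 -> uniq L -> L != [::] ->
  exists f : G -> 'I_n, (forall x, f x \in L) /\
    forall i, i \in L -> forall v : G -> R, consistent (rk i) v ->
      balanced gamma (size L) v M -> fair (gamma / n%:R ^+ 2) v M f i.
Proof.
move=> /andP[gamma0 gamma1] LU L0; have [f [fL fP]] := round_robin M LU L0.
exists f; split=> // i iL v cv bal; have v0 := cv.1.
have [D Di Ds] := fP i iL v cv; have Dl : (#|D| < size L)%N.
  by apply: leq_ltn_trans Di _; rewrite index_mem.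
move: (bal D Dl) Ds; set B := \sum_(x in M :\: D) v x.
set X := \sum_(x in _ | _) v x => balD BX g gM fg.
have Ln : (size L <= n)%N.
  by rewrite -(card_uniqP LU) -[leqRHS]card_ord max_card.
have n0 : 0 < n%:R :> R by rewrite ltr0n (leq_trans _ Ln) // lt0n size_eq0.
have X0 : 0 <= X by exact: sumr_ge0.
have B0 : 0 <= B by exact: sumr_ge0.
have vD : gamma * \sum_(x in M :&: D) v x <= (size L)%:R * B - B.
  have szL : (size L)%:R = (size L).-1%:R + 1 :> R.
    by rewrite natr1 prednK // lt0n size_eq0.
  rewrite szL mulrDl mul1r addrK mulr_sumr.
  apply: (@sum_le_card _ _ (fun x => gamma * v x)) => // [|x /setIP[xM _]].
    rewrite -ltnS prednK ?lt0n ?size_eq0 //.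
    by apply: leq_ltn_trans Dl; rewrite subset_leq_card ?subsetIr.
  exact: balD.
have vM : gamma * \sum_(x in M) v x <= n%:R * B.
  rewrite (sum_setD_setI v M D) mulrDr -/B.
  have : gamma * B <= B by rewrite ler_piMl.
  have : (size L)%:R * B <= n%:R * B by rewrite ler_wpM2r // ler_nat.
  by lra.
rewrite mulrAC ler_pdivrMr ?exprn_gt0 //.
apply: (@le_trans _ _ (gamma * \sum_(x in M) v x)).
  rewrite (ler_wpM2l (ltW gamma0)) //; apply: ler_sum_subset => // x.
  by rewrite !inE -andbA => /and3P[_ ->].
apply: le_trans vM _; rewrite mulrC expr2 mulrA (ler_wpM2r (ltW n0)) //.
by apply: le_trans BX _; rewrite mulrC ler_wpM2l // ler_nat.
Qed.

End RoundRobin.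

(** * The protocol as a decision tree *)

Section Protocol.
Set Implicit Arguments.
Unset Strict Implicit.
Variables (R : realType) (n : nat) (G : finType).

Lemma allocation_of_disjoint (f : G -> 'I_n) i j :
  i != j -> [disjoint [set x | f x == i] & [set x | f x == j]].
Proof.
move=> ij; rewrite -setI_eq0; apply/eqP/setP => x; rewrite !inE.
by apply/andP => -[/eqP-> /eqP]; exact/eqP.
Qed.

Lemma allocation_of_cover (f : G -> 'I_n) :
  \bigcup_i [set x | f x == i] = [set: G].
Proof.
by apply/setP => x; rewrite inE; apply/bigcupP; exists (f x); rewrite ?inE.
Qed.

Definition allocation_of (f : G -> 'I_n) : allocation n G :=
  Allocation (allocation_of_disjoint f) (allocation_of_cover f).

Fixpoint query_all (i : 'I_n) (gs : seq G) (next : seq R -> query_tree R n G) :=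
  if gs is g :: gs' then
    Query i g (fun x => query_all i gs' (fun l => next (x :: l)))
  else next [::].

Lemma run_query_all i gs next v :
  run (query_all i gs next) v = run (next (map (v i) gs)) v.
Proof. by elim: gs next => //= g gs IH next; rewrite IH. Qed.

Lemma num_queries_query_all i gs next v j :
  num_queries (query_all i gs next) v j =
    ((i == j) * size gs + num_queries (next (map (v i) gs)) v j)%N.
Proof.
elim: gs next => [|g gs IH] next /=; first by rewrite muln0.
by rewrite IH mulnS addnA.
Qed.

Lemma fair_le (alpha beta : R) v M (f : G -> 'I_n) i :
  (forall g, 0 <= v g) -> alpha <= beta -> fair beta v M f i -> fair alpha v M f i.
Proof.
move=> v0 ab fb g gM fg; apply: le_trans (fb g gM fg).
by rewrite ler_wpM2r // sumr_ge0.
Qed.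

Variables (rk : 'I_n -> rel G) (k : nat) (alpha gamma : R).
Hypothesis rkS : forall i, strict_linear_order (rk i).
Hypothesis alpha_ge0 : 0 <= alpha.
Hypothesis gamma01 : 0 < gamma <= 1.
Hypothesis alpha_gamma : alpha <= gamma / n%:R ^+ 2.
Hypothesis query_dichotomy : forall r (M : {set G}),
  strict_linear_order r -> M != set0 ->
  exists g (gs : seq G) (test : seq R -> bool), [/\ g \in M, size gs = k &
    forall v, consistent r v ->
      if test (map v gs) then balanced gamma n v M
      else alpha * \sum_(x in M :\ g) v x <= v g].

(* [P] lists the agents that were not queried yet, [S] those for which the
   remaining goods [M] are known to be balanced. *)
Lemma protocol (P S : seq 'I_n) (M : {set G}) (f0 : G -> 'I_n) :
  uniq (P ++ S) -> P ++ S != [::] ->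
  exists t : query_tree R n G, forall v : 'I_n -> G -> R,
    (forall i, consistent (rk i) (v i)) ->
    (forall i, i \in S -> balanced gamma (size (P ++ S)) (v i) M) ->
    (forall i, num_queries t v i <= (i \in P) * k)%N /\
    exists f, [/\ run t v = allocation_of f,
      forall x, x \notin M -> f x = f0 x,
      forall x, x \in M -> f x \in P ++ S &
      forall i, i \in P ++ S -> fair alpha (v i) M f i].
Proof.
elim: P => [|i P IH] /= in S M f0 *.
  move=> SU S0; have [f [fS ffair]] := round_robin_fair rkS M gamma01 SU S0.
  (* [f0] remembers the owners of goods taken by departed agents. *)
  pose f' x := if x \in M then f x else f0 x.
  exists (Output R (allocation_of f')) => v cv bal; split=> //.
  have f'M x : x \in M -> f' x = f x by rewrite /f' => ->.
  exists f'; split=> // [x|x /f'M->//|j jS]; first by rewrite /f' => /negPf->.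
  have := fair_le (cv j).1 alpha_gamma (ffair j jS (v j) (cv j) (bal j jS)).
  move=> fj g gM; rewrite f'M // => /(fj g gM).
  congr (_ * _ <= _); apply: eq_bigl => x.
    by rewrite !inE; case: (boolP (x \in M)) => [/f'M->//|]; rewrite andbF.
  by case: (boolP (x \in M)) => // /f'M->.
move=> /andP[iPS PSU] _.
have pe : perm_eql (P ++ i :: S) (i :: P ++ S).
  by move=> s; rewrite (perm_catCA P [:: i] S).
have sizeE := perm_size (introT permPl pe).
have memE := perm_mem (introT permPl pe).
(* [t1] is the continuation in which [i] waits. *)
have [||t1 H1] := IH (i :: S) M f0.
- by rewrite (perm_uniq (introT permPl pe)) /= iPS.
- by rewrite -size_eq0 sizeE.
have {}H1 v : (forall i, consistent (rk i) (v i)) ->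
    (forall j, j \in S -> balanced gamma (size (P ++ S)).+1 (v j) M) ->
    balanced gamma (size (P ++ S)).+1 (v i) M ->
    (forall j, num_queries t1 v j <= (j \in P) * k)%N /\
    exists f, [/\ run t1 v = allocation_of f,
      forall x, x \notin M -> f x = f0 x,
      forall x, x \in M -> f x \in i :: P ++ S &
      forall j, j \in i :: P ++ S -> fair alpha (v j) M f j].
  move=> cv balS bali; have [|nq [f [rf fo fM ff]]] := H1 v cv.
    by move=> j; rewrite sizeE /= inE => /predU1P[->|/balS].
  split=> //; exists f; split=> // [x /fM|j]; first by rewrite memE.
  by rewrite -memE; exact: ff.
(* Without goods balance is vacuous, so [i] waits unqueried. *)
have [M0|M0] := eqVneq M set0.
  exists t1 => v cv bal; have [|nq Hf] := H1 v cv bal.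
    by rewrite M0 => D _ g; rewrite inE.
  split=> // j; apply: leq_trans (nq j) _; rewrite inE leq_mul2r.
  by case: (j == i); case: (j \in P); rewrite ?orbT.
(* A sole remaining agent waits unqueried: only the empty [D] matters, and [gamma <= 1]. Hence a
   departure always leaves someone to take the remaining goods. *)
have [PS0|PS0] := eqVneq (P ++ S) [::].
  exists t1 => v cv bal; have [|nq Hf] := H1 v cv bal.
    move=> D; rewrite PS0 ltnS leqn0 cards_eq0 => /eqP-> g gM.
    have v0 := (cv i).1; case/andP: gamma01 => _ g1.
    rewrite setD0 (big_setD1 g gM) /= ler_wpDr ?sumr_ge0 //.
    by rewrite ler_piMl.
  split=> // j; apply: leq_trans (nq j) _; rewrite inE leq_mul2r.
  by case: (j == i); case: (j \in P); rewrite ?orbT.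
have [g [gs [test [gM gsk Htest]]]] := query_dichotomy (rkS i) M0.
(* [t2] is the continuation in which [i] leaves with [g]. *)
have [t2 H2] := IH S (M :\ g) (fun x => if x == g then i else f0 x) PSU PS0.
have size_n : ((size (P ++ S)).+1 <= n)%N.
  have iU : uniq (i :: P ++ S) by rewrite /= iPS.
  rewrite -[_.+1]/(size (i :: P ++ S)) -(card_uniqP iU) -[leqRHS]card_ord.
  exact: max_card.
exists (query_all i gs (fun l => if test l then t1 else t2)) => v cv bal.
have queries t : (forall j, num_queries t v j <= (j \in P) * k)%N ->
    forall j, ((i == j) * size gs + num_queries t v j <= (j \in i :: P) * k)%N.
  move=> nq j; rewrite gsk inE eq_sym; case: eqP => [->|_]; last exact: nq.
  have iP : i \in P = false by move: iPS; rewrite mem_cat; case: (i \in P).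
  by have := nq i; rewrite iP mul0n mul1n leqn0 => /eqP->; rewrite addn0.
have := Htest _ (cv i); case: ifP => [tst bali|tst big].
  have [nq Hf] := H1 v cv bal (balanced_leq size_n bali).
  split=> [j|]; first by rewrite num_queries_query_all tst; exact: queries.
  by rewrite run_query_all tst.
have [|nq [f [rf fo fM ff]]] := H2 v cv.
  by move=> j /bal; exact: balanced_setD1.
split=> [j|]; first by rewrite num_queries_query_all tst; exact: queries.
exists f; rewrite run_query_all tst; split=> // [x xM|x xM|j].
- by rewrite fo ?inE ?(negPf xM) ?andbF //; case: eqP => // xg; rewrite xg gM in xM.
- have [->|xg] := eqVneq x g; first by rewrite fo ?inE ?eqxx // mem_head.
  by rewrite inE fM ?orbT // !inE xg.
have fg : f g = i by rewrite fo ?eqxx // !inE eqxx.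
have fx x : x \in M :\ g -> f x != i.
  by move=> /fM; apply: contraTneq => ->.
have v0 l := (cv l).1.
(* For [i] itself every other bundle within [M] lies in [M :\ g], so [big] suffices. *)
rewrite inE => /predU1P[->|jPS] x xM fxj.
  have xg : x != g by apply: contraNneq fxj => ->; rewrite fg.
  rewrite [leRHS](bigD1 g) /= ?gM ?fg ?eqxx //; apply: ler_wpDr; first exact: sumr_ge0.
  apply: le_trans big; rewrite ler_wpM2l //; apply: ler_sum_subset => // y.
  rewrite !inE => /andP[/andP[_ ->]] /eqP fy; rewrite andbT.
  by apply: contra_eq_neq fy => ->; rewrite fg eq_sym.
have ji : j != i by apply: contraNneq iPS => <-.
have restr : \sum_(y in M | f y == j) v j y = \sum_(y in M :\ g | f y == j) v j y.
  apply: eq_bigl => y; rewrite !inE; have [->|//] := eqVneq y g.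
  by rewrite fg eq_sym (negPf ji) !andbF.
(* Within [M] the bundle of [i] is just [g]; deleting it leaves nothing to envy. *)
have [xg|xg] := eqVneq x g.
  rewrite xg fg big1 ?mulr0 ?sumr_ge0 // => y /andP[yM].
  by rewrite (negPf (fx y yM)).
have xM' : x \in M :\ g by rewrite !inE xg.
rewrite restr; apply: le_trans (ff j jPS x xM' fxj).
rewrite ler_wpM2l //; apply: ler_sum_subset => // y.
rewrite !inE => /andP[/andP[-> ->] fy]; rewrite fy !andbT.
by apply: contraTneq fy => ->; rewrite fg eq_sym fx.
Qed.

End Protocol.

(** * Choice of the positions and constants; the resulting algorithm *)

Lemma query_positions (R : realType) (n m k : nat) (a : R) :
  1 <= a -> (0 < k)%N -> (0 < n)%N -> a ^+ (k.*2.-1) = m%:R ->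
  exists p : nat -> nat, [/\ forall j, (n.*2 <= p j)%N, (m <= p k.-1)%N,
    forall j, (p j.+1)%:R <= 2 * a ^+ 2 * (p j)%:R &
    (p 0%N)%:R <= 4 * n%:R * a].
Proof.
(* Rounding up costs at most a factor 2 because [a >= 1]. At [j = k - 1] the exponent is [2k - 1],
   where the power equals [m]. *)
move=> a1 k0 n0 am; pose t j := (Num.truncn (a ^+ j.*2.+1)).+1.
have a0 : 0 <= a by exact: le_trans a1.
have t_gt j : a ^+ j.*2.+1 <= (t j)%:R by exact/ltW/truncnS_gt.
have t_lt j : (t j)%:R <= 2 * a ^+ j.*2.+1.
  rewrite /t -natr1 mulr_natl mulr2n lerD ?exprn_ege1 //.
  by rewrite truncn_le exprn_ge0.
exists (fun j => n.*2 * t j)%N; split.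
- by move=> j; rewrite leq_pmulr.
- have mt : (m <= t k.-1)%N.
    rewrite -(ler_nat R) -am; apply: le_trans (t_gt _).
    by rewrite -[in leLHS](prednK k0).
  by apply: leq_trans mt _; rewrite leq_pmull // double_gt0.
- move=> j; rewrite !natrM mulrCA ler_wpM2l //.
  apply: le_trans (t_lt _) _; rewrite -[j.+1.*2.+1]/(2 + j.*2.+1)%N exprD mulrA.
  by rewrite ler_wpM2l // mulr_ge0 // exprn_ge0.
- rewrite natrM -muln2 natrM; have := t_lt 0%N; rewrite expr1.
  by have : 0 <= n%:R :> R by []; nra.
Qed.

Theorem corollary4p3 (R : realType) (n : nat) (hn : (2 <= n)%N) :
  exists c : R, 0 < c /\
    forall (m k : nat) (G : finType),
      #|G| = m -> (n <= m)%N -> (1 <= k)%N ->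
      exists A : algorithm R n G,
        k_query k A /\
        forall I : instance R n G,
          EFX (c / (Num.sqrt k%:R * m%:R `^ (1 / (2 * k%:R - 1))))
              (value I) (outcome A I).
Proof.
have n0 : (0 < n)%N by exact: leq_trans hn.
have nR : 1 <= n%:R :> R by rewrite ler1n.
(* [6 = 4 + 2]: [4 n a] bounds [p 0] and [2 a sqrt k] bounds the blocks. The same constant covers
   the loss [2 n ^ 2] of the waiting agents. *)
exists ((6 * n%:R ^+ 2)^-1); split.
  by rewrite invr_gt0 mulr_gt0 // exprn_gt0 // (lt_le_trans ltr01).
move=> m k G Gm nm k0; have m0 : (0 < m)%N by exact: leq_trans nm.
set a := m%:R `^ _; set b := Num.sqrt k%:R.
have kR : 1 <= k%:R :> R by rewrite ler1n.
have a1 : 1 <= a.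
  by rewrite -[leLHS](powRr0 m%:R) ler_powR ?ler1n // divr_ge0 //; lra.
have b1 : 1 <= b by rewrite -[leLHS]sqrtr1 ler_wsqrtr.
have bb : b ^+ 2 = k%:R by rewrite sqr_sqrtr.
have am : a ^+ (k.*2.-1) = m%:R.
  have kE : (k.*2.-1)%:R = 2 * k%:R - 1 :> R.
    by rewrite -subn1 natrB ?double_gt0 // -muln2 natrM mulrC.
  rewrite -powR_mulrn ?(le_trans _ a1) // -powRrM kE divfK ?powRr1 //.
  by apply/eqP; lra.
have [p [pn pm prho p0]] := query_positions a1 k0 n0 am.
have b0 : 0 < b by lra.
have a0 : 0 < a by lra.
pose beta := (a * b)^-1.
have beta01 : 0 < beta <= 1.
  rewrite invr_gt0 mulr_gt0 // invf_le1 ?mulr_gt0 //.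
  by rewrite -[leLHS]mulr1 ler_pM.
pose alpha := (6 * n%:R ^+ 2)^-1 / (b * a).
have alphaE : alpha = beta / (6 * n%:R ^+ 2).
  by rewrite /alpha /beta mulrC (mulrC b).
have N1 : 1 <= n%:R ^+ 2 :> R by exact: exprn_ege1.
have alpha0 : 0 <= alpha.
  by rewrite alphaE divr_ge0 // ?mulr_ge0 // ltW //; case/andP: beta01.
have alpha_gamma : alpha <= beta / 2 / n%:R ^+ 2.
  rewrite alphaE -[leRHS]mulrA -[2^-1 / _]invfM.
  rewrite ler_wpM2l //; first by case/andP: beta01 => /ltW.
  by rewrite lef_pV2 ?posrE; lra.
have alpha1 : alpha <= 1.
  rewrite alphaE ler_pdivrMr; last by lra.
  by case/andP: beta01; lra.
have dichotomy r (M : {set G}) : strict_linear_order r -> M != set0 ->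
  exists g (gs : seq G) (test : seq R -> bool), [/\ g \in M, size gs = k &
    forall v, consistent r v ->
      if test (map v gs) then balanced (beta / 2) n v M
      else alpha * \sum_(x in M :\ g) v x <= v g].
  move=> rS M0.
  have Mp : (#|M| <= p k.-1)%N by apply: leq_trans pm; rewrite -Gm max_card.
  have [||g [gs [test [gM gsk H]]]] :=
    query_test (beta := beta) rS M0 _ _ k0 pn Mp prho.
  - by case/andP: beta01 => /ltW.
  - by rewrite mulr_ge0 // sqr_ge0.
  exists g, gs, test; split=> // v cv; have := H v cv; case: ifP => // _ big.
  apply: le_trans (ler_wpM2l alpha0 big) _; rewrite [leLHS]mulrA ler_piMl ?cv.1 //.
  set X := (X in alpha * X).
  (* As [k = b ^ 2] and [beta = 1 / (a b)], the blocks cost [2 / beta]: this balance between the two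
     outcomes of the test dictates [beta]. *)
  have kbeta : k%:R * (2 * a ^+ 2 * beta) = 2 * (a * b).
    by rewrite -bb /beta; field; rewrite !gt_eqF.
  have XE : X <= 6 * n%:R ^+ 2 * (a * b).
    have ab0 : 0 <= a * b by rewrite mulr_ge0 // ltW.
    have nab : n%:R * a <= n%:R ^+ 2 * (a * b).
      rewrite expr2 -mulrA ler_wpM2l //; apply: (@le_trans _ _ (a * b)).
        by rewrite ler_peMr // ltW.
      by rewrite ler_peMl.
    have ab : a * b <= n%:R ^+ 2 * (a * b) by rewrite ler_peMl.
    by rewrite /X kbeta; lra.
  have nR0 : 0 < n%:R :> R by rewrite ltr0n.
  apply: le_trans (ler_wpM2l alpha0 XE) _; rewrite alphaE /beta.
  by rewrite le_eqVlt; apply/orP; left; apply/eqP; field; rewrite !gt_eqF.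
(* The tree is fixed by the rankings [P] before the instance. If [P] is not made of linear orders,
   no instance has it and any output will do. *)
have algo (P : 'I_n -> rel G) : exists t : query_tree R n G,
    forall I : instance R n G, prefers I = P ->
      (forall i, num_queries t (value I) i <= k)%N /\
      EFX alpha (value I) (run t (value I)).
  have [PS|notPS] := pselect (forall i, strict_linear_order (P i)); last first.
    exists (Output R (allocation_of (fun=> Ordinal n0))) => I IP.
    exfalso; apply: notPS.
    by rewrite -IP => i; exact: prefers_slo.
  have beta2 : 0 < beta / 2 <= 1 by case/andP: beta01; lra.
  have [||t Ht] := protocol (P := enum 'I_n) (S := [::])
    PS alpha0 beta2 alpha_gamma dichotomy [set: G] (fun=> Ordinal n0).
  - by rewrite cats0 enum_uniq.
  - by rewrite cats0 -size_eq0 size_enum_ord -lt0n.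
  exists t => I IP; have [|//|nq [f [-> _ _ ff]]] := Ht (value I).
    move=> i; split; first exact: value_ge0.
    by move=> g g'; rewrite -IP; exact: prefers_consistent.
  split=> [i|]; first by have := nq i; rewrite mem_enum mul1n.
  split; first by rewrite alpha0.
  move=> i j ij _ g; rewrite /= inE => /eqP fg.
  have := ff i _ g (in_setT g); rewrite cats0 mem_enum fg eq_sym ij.
  move=> /(_ isT isT); rewrite /bundle_value /=.
  congr (_ * _ <= _); apply: eq_bigl => x; rewrite !inE ?andbT //.
have [A HA] := choice algo.
exists A; split=> [I i|I]; first exact: (HA _ I erefl).1.
exact: (HA _ I erefl).2.
Qed.
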